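(* Let $d,m\ge 1$ be integers, let $A_1,\ldots,A_m$ be normal matrices in $\mathbb{M}_d$ and let $q$ be a real number with $0<q\le 1$. Then there exist unitary matrices $V_1,\ldots,V_d\in\mathbb{M}_d$ such that $$ \left|\sum_{k=1}^m A_k\right|\le \frac{1}{d}\sum_{i=1}^d V_i\left\{\sum_{k=1}^m |A_k|^q\right\}^{1/q}V_i^*. $$
   Context: $\mathbb{M}_d$ is the space of complex $d\times d$ matrices. For $A\in\mathbb{M}_d$, $|A|=(A^*A)^{1/2}$. Powers of positive semidefinite matrices are defined by the usual spectral functional calculus. The inequality $X\le Y$ between Hermitian matrices is the usual (Loewner) order: $Y-X$ is positive semidefinite. *)

(* Defs.v *)
From mathcomp Require Import all_boot all_order all_algebra.
From mathcomp Require Import complex spectral sesquilinear.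
From mathcomp Require Import reals exp.

Set Implicit Arguments.
Unset Strict Implicit.
Unset Printing Implicit Defensive.

Import Order.TTheory GRing.Theory Num.Theory.

Local Open Scope ring_scope.
Local Open Scope complex_scope.
Local Open Scope sesquilinear_scope.

(* Spectral functional calculus. [spectralmx A] is a unitary matrix P with
   A = P^-1 D P, D diagonal, whenever A is normal. The eigenvalues of a
   Hermitian matrix are real, so for such A taking [complex.Re] loses nothing
   and the result does not depend on the choice of P. The definition is
   only meaningful for Hermitian A. *)
Definition mxfun (R : realType) (n : nat) (f : R -> R) (A : 'M[R[i]]_n) :
    'M[R[i]]_n :=
  invmx (spectralmx A) *m
  diag_mx (map_mx (fun z : R[i] => (f (complex.Re z))%:C) (spectral_diag A)) *m
  spectralmx A.

(* Only meaningful for positive semidefinite A. On [0, +oo[, x `^ p is the usual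
   real power, with 0 `^ p = 0 for p != 0. *)
Definition mxpow (R : realType) (n : nat) (A : 'M[R[i]]_n) (p : R) :
    'M[R[i]]_n :=
  mxfun (fun x : R => powR x p) A.

Definition mxabs (R : realType) (n : nat) (A : 'M[R[i]]_n) : 'M[R[i]]_n :=
  mxpow (A^t* *m A) (2%:R^-1).

(* In R[i], [0 <= z] says that z is real and nonnegative. *)
Definition psdmx (R : realType) (n : nat) (A : 'M[R[i]]_n) : Prop :=
  A \is hermsymmx /\ forall v : 'cV[R[i]]_n, 0 <= (v^t* *m A *m v) 0 0.

(* Loewner order; used on Hermitian matrices. *)
Definition loewner_le (R : realType) (n : nat) (X Y : 'M[R[i]]_n) : Prop :=
  psdmx (Y - X).

(* Main.v *)
Require Import Defs.
From mathcomp Require Import all_boot all_order all_algebra.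
From mathcomp Require Import perm cyclic separable cyclotomic.
From mathcomp Require Import complex spectral sesquilinear.
From mathcomp Require Import boolp reals topology normedtype sequences exp.
From mathcomp Require Import zify ring lra.

(* Put T = sum A_k, S = sum |A_k|, B = sum |A_k|^q. The theorem follows from the
   chain of weak majorizations |T| < S < B^(1/q) of ordered eigenvalues.
   - |T| < S: for normal A one has 2 Re <u, A v> <= <u, |A| u> + <v, |A| v>; sum
     this over k and over singular vectors u_j, v_j of T, and apply Ky Fan's
     maximum principle to S.
   - S < B^(1/q): let e_j be the ordered eigenvectors of S and M = |A_k|. As
     x^(q-1) decreases, sum_(j<k) <e_j, S^(q-1) M e_j> is at most
     sum_(j<k) <e_j, M^(1/2) S^(q-1) M^(1/2) e_j> (Ando-Zhan), and
     M^(1/2) S^(q-1) M^(1/2) <= M^q by the Loewner-Heinz inequality. Summing over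
     all M gives S^q < B by Ky Fan, and convexity of x^(1/q) concludes.
   By Horn's theorem a weak majorization s < y of the eigenvalues of X and Y
   yields a unitary Z such that the diagonal of Z Y Z^* dominates s, and that
   diagonal is the average of D^l Z Y Z^* D^-l for l < d, where D is the diagonal
   matrix of the d-th roots of unity. *)

Set Implicit Arguments.
Unset Strict Implicit.
Unset Printing Implicit Defensive.

Import Order.TTheory GRing.Theory Num.Theory.
Import numFieldNormedType.Exports.

Local Open Scope ring_scope.
Local Open Scope complex_scope.
Local Open Scope sesquilinear_scope.

(** * Quadratic forms of row vectors and functional calculus of Hermitian matrices *)

Section Basics.
Variable R : realType.
Local Notation C := R[i].

Definition csq (z : C) : R := complex.Re z ^+ 2 + complex.Im z ^+ 2.

(** Vectors are rows: for unitary [Q] the rows of [Q] are eigenvectors of [spec Q l], and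
    [v *m Q^t*] lists the coordinates of [v] in that basis. Taking the real part keeps all
    comparisons in [R]. *)
Definition qf n (A : 'M[C]_n) (v : 'rV[C]_n) : R :=
  complex.Re ((v *m A *m v^t*) 0 0).

(* Locked: otherwise unification compares distinct [spec Q l] and [spec P m] by
   unfolding the matrix products. *)
Fact spec_key : unit. Proof. exact: tt. Qed.

Definition spec n (Q : 'M[C]_n) (l : 'I_n -> R) : 'M[C]_n :=
  locked_with spec_key (Q^t* *m diag_mx (\row_i (l i)%:C) *m Q).

Lemma specE n (Q : 'M[C]_n) l :
  spec Q l = Q^t* *m diag_mx (\row_i (l i)%:C) *m Q.
Proof. by rewrite /spec locked_withE. Qed.

Lemma csqE z : (csq z)%:C = z * z^*%R.
Proof. by rewrite add_Re2_Im2 normCK. Qed.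

Lemma csq_ge0 z : 0 <= csq z.
Proof. by rewrite addr_ge0 ?sqr_ge0. Qed.

Lemma csq_conj z : csq (z^*)%R = csq z.
Proof. by apply: (@complexI R); rewrite !csqE conjCK mulrC. Qed.

Lemma csq_real (x : R) : csq x%:C = x ^+ 2.
Proof. by rewrite /csq /= expr0n addr0. Qed.

Lemma Re_add (x y : C) : complex.Re (x + y) = complex.Re x + complex.Re y.
Proof. by case: x => a b; case: y. Qed.

Lemma Re_sum I (r : seq I) (P : pred I) (F : I -> C) :
  complex.Re (\sum_(i <- r | P i) F i) = \sum_(i <- r | P i) complex.Re (F i).
Proof. by apply: (big_morph _ Re_add). Qed.

Lemma Re_realM (a : R) (z : C) : complex.Re (a%:C * z) = a * complex.Re z.
Proof. by case: z => x y /=; rewrite mul0r subr0. Qed.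

Lemma adjM m n p (A : 'M[C]_(m, n)) (B : 'M[C]_(n, p)) :
  (A *m B)^t* = B^t* *m A^t*.
Proof. by rewrite trmx_mul map_mxM. Qed.

Lemma adjD m n (A B : 'M[C]_(m, n)) : (A + B)^t* = A^t* + B^t*.
Proof. by rewrite linearD map_mxD. Qed.

Lemma adjZ m n (a : C) (A : 'M[C]_(m, n)) : (a *: A)^t* = (a^*)%R *: A^t*.
Proof. by rewrite linearZ map_mxZ. Qed.

Lemma adj_sum m n I (r : seq I) (P : pred I) (F : I -> 'M[C]_(m, n)) :
  (\sum_(i <- r | P i) F i)^t* = \sum_(i <- r | P i) (F i)^t*.
Proof. by rewrite raddf_sum map_mx_sum. Qed.

Lemma qf_mul n (X A : 'M[C]_n) v : qf (X *m A *m X^t*) v = qf A (v *m X).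
Proof. by rewrite /qf adjM !mulmxA. Qed.

Lemma qf_diag n (l : 'I_n -> R) v :
  qf (diag_mx (\row_i (l i)%:C)) v = \sum_i l i * csq (v 0 i).
Proof.
rewrite /qf mul_mx_diag mxE Re_sum; apply: eq_bigr => i _.
rewrite !mxE mulrAC mulrC Re_realM; congr (_ * _).
by rewrite -csqE.
Qed.

Lemma qf_spec n (Q : 'M[C]_n) l v :
  qf (spec Q l) v = \sum_i l i * csq ((v *m Q^t*) 0 i).
Proof.
by rewrite specE -{2}[Q]trmxCK qf_mul qf_diag.
Qed.

Lemma qf1E n (v : 'rV[C]_n) : qf 1%:M v = \sum_i csq (v 0 i).
Proof.
rewrite /qf mulmx1 mxE Re_sum; apply: eq_bigr => i _.
by rewrite !mxE -csqE.
Qed.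

Lemma qf1_ge0 n (v : 'rV[C]_n) : 0 <= qf 1%:M v.
Proof. by rewrite qf1E sumr_ge0 // => i _; rewrite csq_ge0. Qed.

Lemma csq_eq0 z : csq z = 0 -> z = 0.
Proof.
move=> z0; apply/eqP; move: (csqE z); rewrite z0 -normCK => /esym/eqP.
by rewrite expf_eq0 normr_eq0.
Qed.

Lemma qf1_eq0 n (v : 'rV[C]_n) : qf 1%:M v = 0 -> v = 0.
Proof.
rewrite qf1E => /eqP; rewrite psumr_eq0 => [/allP h|i _]; last exact: csq_ge0.
apply/rowP => i; rewrite mxE; apply/csq_eq0/eqP.
by have := h i (mem_index_enum i).
Qed.

Lemma qfD n (A B : 'M[C]_n) v : qf (A + B) v = qf A v + qf B v.
Proof. by rewrite /qf mulmxDr mulmxDl mxE Re_add. Qed.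

Lemma qf0 n v : qf (0 : 'M[C]_n) v = 0.
Proof. by rewrite /qf mulmx0 mul0mx mxE. Qed.

Lemma qf_sum n I (r : seq I) (P : pred I) (F : I -> 'M[C]_n) v :
  qf (\sum_(i <- r | P i) F i) v = \sum_(i <- r | P i) qf (F i) v.
Proof.
apply: (big_morph (fun A => qf A v)) => [A B|]; [exact: qfD | exact: qf0].
Qed.

Lemma qfZ n (A : 'M[C]_n) (a : C) v : qf A (a *: v) = csq a * qf A v.
Proof.
rewrite /qf adjZ -!scalemxAl -scalemxAr scalerA mxE.
by rewrite -csqE Re_realM.
Qed.

Lemma unitary_adjl n (Q : 'M[C]_n) : Q \is unitarymx -> Q^t* *m Q = 1%:M.
Proof. by move=> u; rewrite -invmx_unitary // mulVmx // unitarymx_unit. Qed.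

Lemma unitary_adj n (Q : 'M[C]_n) : Q \is unitarymx -> Q^t* \is unitarymx.
Proof. by rewrite trmxC_unitary. Qed.

Lemma spec_mul n (Q : 'M[C]_n) f g : Q \is unitarymx ->
  spec Q f *m spec Q g = spec Q (fun i => f i * g i).
Proof.
move=> u; have K (X : 'M_n) : Q *m (Q^t* *m X) = X.
  by rewrite mulmxA (unitarymxP u) mul1mx.
rewrite !specE -!mulmxA K (mulmxA (diag_mx _) (diag_mx _)) mulmx_diag.
suff -> : \row_j ((\row_i (f i)%:C) 0 j * (\row_i (g i)%:C) 0 j) =
  \row_i (f i * g i)%:C :> 'rV[C]_n by [].
by apply/rowP => i; rewrite !mxE rmorphM.
Qed.

Lemma eq_spec n (Q : 'M[C]_n) f g : f =1 g -> spec Q f = spec Q g.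
Proof.
move=> e; have E : \row_i (f i)%:C = \row_i (g i)%:C :> 'rV[C]_n.
  by apply/rowP => i; rewrite !mxE e.
by rewrite !specE E.
Qed.

Lemma spec1 n (Q : 'M[C]_n) : Q \is unitarymx -> spec Q (fun=> 1) = 1%:M.
Proof.
move=> u; rewrite specE.
have -> : (\row__ (1 : R)%:C) = const_mx 1 :> 'rV[C]_n by apply/rowP => i; rewrite !mxE.
by rewrite diag_const_mx mulmx1 unitary_adjl.
Qed.

Lemma spec_adj n (Q : 'M[C]_n) f : (spec Q f)^t* = spec Q f.
Proof.
rewrite !specE !adjM trmxCK mulmxA tr_diag_mx map_diag_mx.
suff -> : map_mx Num.conj (\row_i (f i)%:C) = \row_i (f i)%:C by [].
by apply/rowP => i; rewrite !mxE; exact: conjc_real.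
Qed.

Lemma qf_unitary n (Q : 'M[C]_n) v : Q \is unitarymx ->
  qf 1%:M (v *m Q) = qf 1%:M v.
Proof. by move=> u; rewrite -qf_mul mulmx1 (unitarymxP u). Qed.

Lemma qf1_unitaryE n (Q : 'M[C]_n) v : Q \is unitarymx ->
  qf 1%:M v = \sum_i csq ((v *m Q^t*) 0 i).
Proof.
by move=> u; rewrite -qf1E (qf_unitary v (unitary_adj u)).
Qed.

Lemma mul_row_spec n (Q : 'M[C]_n) l i : Q \is unitarymx ->
  row i Q *m spec Q l = (l i)%:C *: row i Q.
Proof.
move=> u; rewrite !specE !mulmxA -row_mul (unitarymxP u) row1.
have -> : delta_mx 0 i *m diag_mx (\row_i (l i)%:C) = (l i)%:C *: delta_mx 0 i :> 'rV[C]_n.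
  apply/rowP => j; rewrite mul_mx_diag !mxE eqxx /=.
  by case: eqP => [->|_]; rewrite ?mul1r ?mulr1 ?mul0r ?mulr0.
by rewrite -scalemxAl -rowE.
Qed.

Lemma hermP n (A : 'M[C]_n) : reflect (A^t* = A) (A \is hermsymmx).
Proof.
apply: (iffP (is_hermitianmxP _ _ _)) => /=; rewrite expr0 scale1r => h; exact: esym.
Qed.

Lemma mxfun_spectral n (A : 'M[C]_n) : A \is hermsymmx ->
  exists Q (l : 'I_n -> R), [/\ Q \is unitarymx, A = spec Q l &
    forall f, mxfun f A = spec Q (f \o l)].
Proof.
move=> hA; have nA := hermitian_normalmx hA.
have u := spectral_unitarymx A.
exists (spectralmx A), (fun i => complex.Re (spectral_diag A 0 i)); split=> //.
  rewrite specE -(invmx_unitary u).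
  have <- : spectral_diag A = \row_i (complex.Re (spectral_diag A 0 i))%:C.
    apply/rowP => i; rewrite mxE RRe_real //.
    by move/mxOverP: (hermitian_spectral_diag_real hA); apply.
  exact: (orthomx_spectralP nA).
move=> f; rewrite /mxfun specE -(invmx_unitary u).
suff -> : map_mx (fun z : C => (f (complex.Re z))%:C) (spectral_diag A) =
  \row_i ((f \o (fun i => complex.Re (spectral_diag A 0 i))) i)%:C by [].
by apply/rowP => i; rewrite !mxE.
Qed.

(** The matrix [W := P *m Q^t*] intertwines the two diagonals, so [m i = l j] wherever [W i j] is
    nonzero. Hence [W] intertwines the images under [f] as well. This frees [mxfun] from the
    diagonalization chosen by [spectralmx]. *)
Lemma spec_uniq n (P Q : 'M[C]_n) (m l : 'I_n -> R) (f : R -> R) :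
  P \is unitarymx -> Q \is unitarymx -> spec P m = spec Q l ->
  spec P (f \o m) = spec Q (f \o l).
Proof.
move=> uP uQ; rewrite !specE => E.
pose W := P *m Q^t*.
have e0 : diag_mx (\row_i (m i)%:C) *m W = W *m diag_mx (\row_i (l i)%:C).
  have := congr1 (fun X => P *m X *m Q^t*) E.
  rewrite /W !mulmxA (unitarymxP uP) mul1mx => ->.
  by rewrite -!mulmxA (unitarymxP uQ) mulmx1.
have e1 : diag_mx (\row_i ((f \o m) i)%:C) *m W = W *m diag_mx (\row_i ((f \o l) i)%:C).
  apply/matrixP => i j; move/matrixP/(_ i j): e0.
  rewrite !mul_diag_mx !mul_mx_diag !mxE /=.
  have [->|nz] := eqVneq (\sum_j0 P i j0 * Q^t* j0 j) 0.
    by rewrite !mulr0 !mul0r.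
  by rewrite mulrC => /(mulfI nz) /complexI ->; rewrite mulrC.
have := congr1 (fun X => P^t* *m X *m Q) e1.
rewrite /W !mulmxA (unitary_adjl uP) mul1mx => <-.
by rewrite -(mulmxA _ (Q^t*) Q) (unitary_adjl uQ) mulmx1.
Qed.

Lemma mxfunE n (Q : 'M[C]_n) (l : 'I_n -> R) (f : R -> R) :
  Q \is unitarymx -> mxfun f (spec Q l) = spec Q (f \o l).
Proof.
move=> uQ; have /hermP/mxfun_spectral [P [m [uP E ->]]] := spec_adj Q l.
exact: spec_uniq.
Qed.

End Basics.

(** * Orthonormal rows, sorted eigenvalues and contractions *)

Section Spectral.
Variable R : realType.
Local Notation C := R[i].

Lemma row_unitary m n (Q : 'M[C]_(m, n)) i j : Q \is unitarymx ->
  (row i Q *m (row j Q)^t*) 0 0 = (i == j)%:R.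
Proof.
by move=> /row_unitarymxP/(_ i j); rewrite dotmxE.
Qed.

Lemma qf1_row m n (Q : 'M[C]_(m, n)) i : Q \is unitarymx -> qf 1%:M (row i Q) = 1.
Proof. by move=> u; rewrite /qf mulmx1 row_unitary // eqxx. Qed.

Lemma qf_row_spec n (Q : 'M[C]_n) l i : Q \is unitarymx ->
  qf (spec Q l) (row i Q) = l i.
Proof.
move=> u; rewrite /qf mul_row_spec // -scalemxAl mxE Re_realM.
by rewrite row_unitary // eqxx mulr1.
Qed.

Lemma spec_entry n (Q : 'M[C]_n) l i j :
  spec Q l i j = \sum_k (Q k i)^*%R * (l k)%:C * Q k j.
Proof.
rewrite specE mul_mx_diag mxE; apply: eq_bigr => k _.
by rewrite !mxE.
Qed.

(** The sorted eigenvalues are extended by 0 to all of [nat]; nonnegativity keeps the extension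
    nonincreasing, and partial sums then need no bound proofs. *)
Lemma psd_sorted_spectral n (A : 'M[C]_n) : A \is hermsymmx ->
  (forall v, 0 <= qf A v) ->
  exists Q (s : nat -> R), [/\ Q \is unitarymx, forall i j, (i <= j)%N -> s j <= s i,
    forall i, 0 <= s i & A = spec Q (fun i => s i)].
Proof.
move=> hA pA; have [Q [l [uQ EA _]]] := mxfun_spectral hA.
have l0 i : 0 <= l i by rewrite -(qf_row_spec l i uQ) -EA.
pose t0 := [tuple l i | i < n].
pose t := sort (fun x y : R => y <= x) t0.
have tot : total (fun x y : R => y <= x) by move=> x y; exact: le_total.
have tr : transitive (fun x y : R => y <= x).
  by move=> x y z h1 h2; exact: le_trans h1.
have st : size t == n by rewrite size_sort size_tuple.
have /tuple_permP [p Ep] : perm_eq t t0 by rewrite /= perm_sort.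
have Ei (i : 'I_n) : nth 0 t i = l (p i).
  by rewrite Ep (nth_map i) ?size_enum_ord // nth_ord_enum tnth_mktuple.
have t_ge0 i : 0 <= nth 0 t i.
  have [ilt|ige] := ltnP i n; first by rewrite (Ei (Ordinal ilt)).
  by rewrite nth_default // (eqP st).
exists (row_perm p Q), (nth 0 t); split.
- apply/unitarymxP/matrixP => i j; rewrite !mxE.
  move/unitarymxP/matrixP/(_ (p i) (p j)): uQ; rewrite !mxE (inj_eq perm_inj) => <-.
  by apply: eq_bigr => k _; rewrite !mxE.
- move=> i j ij; have [jlt|jge] := ltnP j n; last first.
    by rewrite (nth_default _ (n := j)) ?(eqP st) ?t_ge0.
  apply: (sorted_leq_nth tr _ 0 (sort_sorted tot t0)) => //=.
  + by rewrite inE (eqP st) (leq_ltn_trans ij).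
  + by rewrite inE (eqP st).
- exact: t_ge0.
- rewrite EA; apply/matrixP => i j; rewrite !spec_entry.
  rewrite (reindex_inj (@perm_inj _ p)); apply: eq_bigr => k _.
  by rewrite !mxE Ei.
Qed.

(** With [w := v *m K^t*], expanding 0 <= |v - w K|^2 gives 2 |w|^2 <= |v|^2 + |w K|^2, and |w K| <=
    |w|. *)
Lemma adj_contraction n (K : 'M[C]_n) :
  (forall v, qf 1%:M (v *m K) <= qf 1%:M v) ->
  forall v, qf 1%:M (v *m K^t*) <= qf 1%:M v.
Proof.
move=> cK v; set w := v *m K^t*.
have E : qf 1%:M (v - w *m K) = qf 1%:M v - 2 * qf 1%:M w + qf 1%:M (w *m K).
  rewrite /qf !mulmx1 linearB map_mxB /= !mulmxBl !mulmxBr.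
  have -> : v *m (w *m K)^t* = w *m w^t* by rewrite adjM mulmxA.
  have -> : w *m K *m v^t* = w *m w^t* by rewrite /w adjM trmxCK !mulmxA.
  have ReN (x : C) : complex.Re (- x) = - complex.Re x by case: x.
  move: (v *m _) (w *m w^t*) (_ *m (w *m K)^t*) => X Y T.
  by rewrite !mxE !(Re_add, ReN); ring.
have := qf1_ge0 (v - w *m K); rewrite E; have := cK w.
by move: (qf _ v) (qf _ w) (qf _ (w *m K)) => a b c; lra.
Qed.

End Spectral.

(** * Loewner-Heinz inequality at midpoints of exponents *)

Section LoewnerHeinz.
Variable R : realType.
Local Notation C := R[i].

(** Bisection: an interval around [r] with endpoints in [D] has its midpoint in [D], so one of its
    halves has the same property. *)
Lemma dyadic_approx (D : R -> Prop) : D 0 -> D 1 ->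
  (forall r s, D r -> D s -> D ((r + s) / 2)) ->
  forall r e : R, 0 <= r <= 1 -> 0 < e -> exists2 a, D a & `|a - r| < e.
Proof.
move=> D0 D1 Dm r e /andP [r0 r1] e0.
have step k : exists a b, [/\ D a, D b, a <= r, r <= b & b - a = 2^-1 ^+ k].
  elim: k => [|k [a [b [Da Db ar rb E]]]]; first by exists 0, 1; split => //; rewrite expr0 subr0.
  have [h|h] := leP r ((a + b) / 2).
    exists a, ((a + b) / 2); split => //; first exact: Dm.
    by rewrite exprS -E; field.
  exists ((a + b) / 2), b; split => //; [exact: Dm | exact: ltW |].
  by rewrite exprS -E; field.
have [k hk] : exists k, 2^-1 ^+ k < e.
  exists (Num.bound e^-1); have /archi_boundP := ltW (eqbRL (invr_gt0 e) e0).
  set k := Num.bound _ => h.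
  have : (k%:R : R) < 2 ^+ k by rewrite -natrX ltr_nat ltn_expl.
  move=> /(lt_trans h); rewrite exprVn -[e in X in _ -> _ < X]invrK.
  by rewrite ltf_pV2 ?posrE ?invr_gt0 ?exprn_gt0.
have [a [b [Da Db ar rb E]]] := step k; exists a => //.
by rewrite ler0_norm ?subr_le0 // opprB (le_lt_trans _ hk) // -E lerD2r.
Qed.

Lemma sqr_le1 (x : R) : x ^+ 2 <= 1 -> x <= 1.
Proof. by move=> h; rewrite leNgt; apply/negP => h1; nra. Qed.

Section OneParameterGroups.
Variables (n : nat) (M S : R -> 'M[C]_n).
Hypotheses (MD : forall r s, M r *m M s = M (r + s)) (M_adj : forall r, (M r)^t* = M r).
Hypotheses (SD : forall r s, S r *m S s = S (r + s)) (S_adj : forall r, (S r)^t* = S r).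
Hypotheses (S0 : S 0 = 1%:M) (M0 : M 0 = 1%:M).

Let le_pow r := forall v, qf (M r) v <= qf (S r) v.

(** Multiplying [M r] and [S r] on both sides by [S (- (r / 2))] turns the larger one into the
    identity. *)
Lemma le_pow_contraction r : le_pow r ->
  forall v, qf 1%:M (v *m (S (- (r / 2)) *m M (r / 2))) <= qf 1%:M v.
Proof.
move=> h v; rewrite mulmxA -qf_mul mulmx1 M_adj MD.
have -> : r / 2 + r / 2 = r by field.
apply: le_trans (h _) _; rewrite -qf_mul S_adj !SD.
have -> : - (r / 2) + r + - (r / 2) = 0 by field.
by rewrite S0.
Qed.

(* [K_r := S^(-r/2) M^(r/2)] is a contraction iff [M^r <= S^r]. Up to similarity
   by a power of [S], [K_r K_s^*] is the Hermitian matrix [K_t K_t^*] with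
   [t := (r + s) / 2], whose eigenvalues are therefore at most 1. *)
Lemma le_pow_mid r s : le_pow r -> le_pow s -> le_pow ((r + s) / 2).
Proof.
set t := (r + s) / 2 => /le_pow_contraction cr /le_pow_contraction/adj_contraction cs.
pose Z := S (- (t / 2)) *m M t *m S (- (t / 2)).
have hZ : Z \is hermsymmx.
  by apply/hermP; rewrite /Z !adjM S_adj M_adj mulmxA.
have [W [z [uW EZ _]]] := mxfun_spectral hZ.
have z1 i : z i <= 1.
  (* This exponent solves both - d - r/2 = - t/2 and - t/2 - d = - s/2, so that [u] is a left
     eigenvector of K_r K_s^* for the eigenvalue [z i]. *)
  pose d := (s - r) / 4.
  pose u := row i W *m S (- d).
  have E : u *m (S (- (r / 2)) *m M (r / 2)) *m (S (- (s / 2)) *m M (s / 2))^t* = (z i)%:C *: u.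
    rewrite adjM S_adj M_adj /u !mulmxA -(mulmxA _ (S (- d))) SD.
    rewrite -(mulmxA _ (M (r / 2)) (M (s / 2))) MD.
    have -> : r / 2 + s / 2 = t by rewrite /t; field.
    have -> : - d - r / 2 = - (t / 2) by rewrite /d /t; field.
    have -> : - (s / 2) = - (t / 2) - d by rewrite /d /t; field.
    rewrite -(SD (- (t / 2))) !mulmxA.
    have -> : row i W *m S (- (t / 2)) *m M t *m S (- (t / 2)) = row i W *m Z by rewrite /Z !mulmxA.
    by rewrite EZ mul_row_spec // -scalemxAl.
  have := le_trans (cs _) (cr u); rewrite E qfZ csq_real.
  have u0 : 0 < qf 1%:M u.
    rewrite lt_def qf1_ge0 andbT; apply/eqP => /qf1_eq0 u0.
    have w0 : row i W = 0.
      by rewrite -[row i W]mulmx1 -S0 -(addNr d) -SD mulmxA -/u u0 mul0mx.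
    have := qf1_row i uW; rewrite w0 /qf !mul0mx mxE /= => /eqP.
    by rewrite eq_sym oner_eq0.
  rewrite -{2}[qf 1%:M u]mul1r ler_pM2r //; exact: sqr_le1.
(* The substitution [w] reduces the claim to [Z <= 1], which the bound on its eigenvalues gives. *)
move=> v; pose w := v *m S (t / 2).
have Ev : v = w *m S (- (t / 2)) by rewrite /w -mulmxA SD subrr S0 mulmx1.
have -> : qf (M t) v = qf Z w by rewrite Ev -qf_mul S_adj.
have -> : qf (S t) v = qf 1%:M w.
  by rewrite /w -qf_mul S_adj mulmx1 SD; congr qf; congr S; field.
rewrite EZ qf_spec (qf1_unitaryE _ uW); apply: ler_sum => i _.
by rewrite ler_piMl ?csq_ge0.
Qed.

(** The adjoint contraction [M (r / 2) *m S (- (r / 2))], applied to [v *m M (- (r / 2))], yields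
    [v *m S (- (r / 2))]. *)
Lemma le_pow_inv r : le_pow r -> forall v, qf (S (- r)) v <= qf (M (- r)) v.
Proof.
move=> /le_pow_contraction/adj_contraction c v.
have e : - (r / 2) - r / 2 = - r by field.
have <- : qf 1%:M (v *m S (- (r / 2))) = qf (S (- r)) v.
  by rewrite -qf_mul mulmx1 S_adj SD e.
have <- : qf 1%:M (v *m M (- (r / 2))) = qf (M (- r)) v.
  by rewrite -qf_mul mulmx1 M_adj MD e.
have := c (v *m M (- (r / 2))).
rewrite adjM S_adj M_adj mulmxA -(mulmxA v) MD.
by rewrite addNr M0 mulmx1.
Qed.

End OneParameterGroups.

Definition specpow n (Q : 'M[C]_n) (l : 'I_n -> R) (r : R) :=
  spec Q (fun i => powR (l i) r).

Lemma specpowD n (X : 'M[C]_n) (x : 'I_n -> R) r s : X \is unitarymx ->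
  (forall i, 0 < x i) -> specpow X x r *m specpow X x s = specpow X x (r + s).
Proof.
move=> uX x0; rewrite /specpow (spec_mul _ _ uX); apply: eq_spec => i.
by rewrite powRD // (gt_eqF (x0 i)) implybT.
Qed.

Lemma specpow0 n (X : 'M[C]_n) (x : 'I_n -> R) : X \is unitarymx ->
  specpow X x 0 = 1%:M.
Proof.
by move=> uX; rewrite /specpow -(spec1 uX); apply: eq_spec => i; rewrite powRr0.
Qed.

Lemma specpow1 n (X : 'M[C]_n) (x : 'I_n -> R) : (forall i, 0 < x i) ->
  specpow X x 1 = spec X x.
Proof. by move=> x0; apply: eq_spec => i; rewrite powRr1 // ltW. Qed.

End LoewnerHeinz.

(** * Loewner-Heinz for real exponents, by continuity; a rearrangement bound *)

Section PowerMonotone.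
Variable R : realType.
(** Continuity in the exponent of a quadratic form of a positive definite power, [c i] being the
    squared coordinates of the vector. It passes from dyadic to real exponents. *)
Lemma powR_sum_near n (c x : 'I_n -> R) (r e : R) : (forall i, 0 < x i) -> 0 < e ->
  exists2 d, 0 < d & forall a, `|a - r| < d ->
    `|\sum_i powR (x i) a * c i - \sum_i powR (x i) r * c i| < e.
Proof.
move=> x0 e0.
have ct (s : seq 'I_n) : continuous (fun a : R => \sum_(i <- s) powR (x i) a * c i).
  elim: s => [|i s IH].
    rewrite (_ : (fun a => _) = (fun=> 0)); first exact: cst_continuous.
    by apply/funext => a; rewrite big_nil.
  rewrite (_ : (fun a => _) =
    (fun a => expR (a * ln (x i)) * c i) \+ (fun a => \sum_(i <- s) powR (x i) a * c i)).
    move=> y; apply: continuousD; last exact: IH.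
    apply: continuousM; last exact: cst_continuous.
    apply: (@continuous_comp R R R (fun a : R => a * ln (x i)) expR y); last exact: continuous_expR.
    by apply: continuousM; [exact: id | exact: cst_continuous].
  by apply/funext => a; rewrite big_cons /powR gt_eqF.
move/cvgrPdist_lt: (ct (index_enum _) r) => /(_ _ e0)/nbhs_ballP [d d0 h].
exists d => // a; rewrite distrC => ad; rewrite distrC; exact: h.
Qed.

Lemma no_near_crossing (a b x y : R) :
  `|a - x| < (x - y) / 2 -> `|b - y| < (x - y) / 2 -> a <= b -> False.
Proof. by rewrite !ltr_norml => /andP [? ?] /andP [? ?] ?; lra. Qed.

(** The exponents [a] for which the order survives contain 0 and 1 and are closed under midpoints,
    hence are dense in [0, 1]; continuity reaches [r]. The inverse form is stated because the
    majorization argument uses the exponent - (1 - q). *)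
Lemma loewner_heinz_inv n (Q P : 'M[R[i]]_n) (mu la : 'I_n -> R) (r : R) :
  Q \is unitarymx -> P \is unitarymx ->
  (forall i, 0 < mu i) -> (forall i, 0 < la i) ->
  (forall v, qf (spec Q mu) v <= qf (spec P la) v) -> 0 <= r <= 1 ->
  forall v, qf (specpow P la (- r)) v <= qf (specpow Q mu (- r)) v.
Proof.
move=> uQ uP mu0 la0 h r01.
pose M := specpow Q mu; pose S := specpow P la.
have MD a b : M a *m M b = M (a + b) by exact: specpowD.
have SD a b : S a *m S b = S (a + b) by exact: specpowD.
have M_adj a : (M a)^t* = M a by exact: spec_adj.
have S_adj a : (S a)^t* = S a by exact: spec_adj.
have M0 : M 0 = 1%:M by exact: specpow0.
have S0 : S 0 = 1%:M by exact: specpow0.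
have ME a v : qf (M a) v = \sum_i powR (mu i) a * csq ((v *m Q^t*) 0 i).
  exact: qf_spec.
have SE a v : qf (S a) v = \sum_i powR (la i) a * csq ((v *m P^t*) 0 i).
  exact: qf_spec.
apply: (le_pow_inv MD M_adj SD S_adj S0 M0) => v.
rewrite leNgt; apply/negP => lt_SM.
pose D a := forall v, qf (M a) v <= qf (S a) v.
have D0 : D 0 by move=> w; rewrite M0 S0.
have D1 : D 1 by move=> w; rewrite /M /S !specpow1.
have Dm a b : D a -> D b -> D ((a + b) / 2).
  exact: (le_pow_mid MD M_adj SD S_adj S0).
(* Half the supposed gap: an exponent in [D] at which both forms move by less than [e] contradicts
   the strict inequality at [r]. *)
pose e := (qf (M r) v - qf (S r) v) / 2.
have e0 : 0 < e by rewrite divr_gt0 ?subr_gt0.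
have [d1 d10 h1] := powR_sum_near (fun i => csq ((v *m Q^t*) 0 i)) r mu0 e0.
have [d2 d20 h2] := powR_sum_near (fun i => csq ((v *m P^t*) 0 i)) r la0 e0.
have d0 : 0 < Num.min d1 d2 by rewrite lt_min d10.
have [a Da] := dyadic_approx D0 D1 Dm r01 d0; rewrite lt_min => /andP [a1 a2].
have k1 : `|qf (M a) v - qf (M r) v| < e by rewrite (ME a v) (ME r v); exact: h1.
have k2 : `|qf (S a) v - qf (S r) v| < e by rewrite (SE a v) (SE r v); exact: h2.
exact: no_near_crossing k1 k2 (Da v).
Qed.

(* [b k] is a threshold: weight moved from the indices [i >= k] to the indices
   [i < k] can only increase the sum. *)
Lemma weighted_sum_le n k (b w : nat -> R) : (k <= n)%N ->
  (forall i j, (i <= j)%N -> b j <= b i) ->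
  (forall i, 0 <= w i <= 1) -> \sum_(0 <= i < n) w i = k%:R ->
  \sum_(0 <= i < n) b i * w i <= \sum_(0 <= i < k) b i.
Proof.
move=> kn bm w01 sw.
have E : \sum_(0 <= i < k) b i - \sum_(0 <= i < n) b i * w i =
  \sum_(0 <= i < k) (b i - b k) * (1 - w i) + \sum_(k <= i < n) (b k - b i) * w i.
  have -> : \sum_(0 <= i < k) (b i - b k) * (1 - w i) =
    \sum_(0 <= i < k) b i - k%:R * b k - \sum_(0 <= i < k) b i * w i +
    b k * \sum_(0 <= i < k) w i.
    have -> : k%:R * b k = \sum_(0 <= i < k) b k.
      by rewrite sumr_const_nat subn0 mulr_natl.
    rewrite big_distrr /= -!sumrB -big_split /=.
    by apply: eq_bigr => i _; ring.
  have -> : \sum_(k <= i < n) (b k - b i) * w i =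
    b k * \sum_(k <= i < n) w i - \sum_(k <= i < n) b i * w i.
    rewrite big_distrr /= -sumrB; by apply: eq_bigr => i _; ring.
  rewrite -sw !(big_cat_nat (leq0n k) kn) /=; ring.
rewrite -subr_ge0 E addr_ge0 //.
  rewrite big_nat_cond sumr_ge0 // => i /andP [/andP [_ ik] _].
  by rewrite mulr_ge0 // subr_ge0; [apply/bm/ltnW | case/andP: (w01 i)].
rewrite big_nat_cond sumr_ge0 // => i /andP [/andP [ki _] _].
by rewrite mulr_ge0 ?subr_ge0; [|apply/bm|case/andP: (w01 i)].
Qed.

End PowerMonotone.

(** * Ky Fan's maximum principle and the Ando-Zhan comparison *)

Section KyFan.
Variable R : realType.
Local Notation C := R[i].

Lemma weighted_sum_ord_le n k (b : nat -> R) (w : 'I_n -> R) : (k <= n)%N ->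
  (forall i j, (i <= j)%N -> b j <= b i) ->
  (forall i, 0 <= w i <= 1) -> \sum_(i < n) w i = k%:R ->
  \sum_(i < n) b i * w i <= \sum_(i < k) b i.
Proof.
move=> kn bm w01 sw.
pose w' i := if insub i is Some j then w j else 0.
have w'E (i : 'I_n) : w' i = w i by rewrite /w' valK.
have w'01 i : 0 <= w' i <= 1.
  by rewrite /w'; case: insubP => [j _ _|_]; [exact: w01 | rewrite lexx ler01].
have sw' : \sum_(0 <= i < n) w' i = k%:R.
  by rewrite -sw big_mkord; apply: eq_bigr => i _; exact: w'E.
have := weighted_sum_le kn bm w'01 sw'; rewrite !big_mkord.
rewrite (eq_bigr (fun i : 'I_n => b i * w i)) // => i _.
by rewrite w'E.
Qed.

(** Pythagoras: [v - w *m W] is orthogonal to the rows of [W], so its squared norm is the difference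
    of the two sides. *)
Lemma bessel k n (W : 'M[C]_(k, n)) v : W \is unitarymx ->
  qf 1%:M (v *m W^t*) <= qf 1%:M v.
Proof.
move=> /unitarymxP u; set w := v *m W^t*.
have Re_opp (x : C) : complex.Re (- x) = - complex.Re x by case: x.
suff E : qf 1%:M (v - w *m W) = qf 1%:M v - qf 1%:M w.
  by rewrite -subr_ge0 -E qf1_ge0.
rewrite /qf !mulmx1 linearB map_mxB /= mulmxBl !mulmxBr.
have -> : v *m (w *m W)^t* = w *m w^t* by rewrite adjM mulmxA.
have -> : w *m W *m v^t* = w *m w^t* by rewrite /w adjM trmxCK !mulmxA.
have -> : w *m W *m (w *m W)^t* = w *m w^t*.
  by rewrite adjM !mulmxA -(mulmxA w) u mulmx1.
by rewrite subrr subr0 !mxE Re_add Re_opp.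
Qed.

(** The left side is the sum of [b i * w i], where [w i] is the squared norm of the projection of
    the [i]-th eigenvector onto the span of the rows of [E]. Bessel gives [w i <= 1], and the [w i]
    add up to [k]. *)
Lemma ky_fan n k (Q : 'M[C]_n) (b : nat -> R) (E : 'M[C]_(k, n)) :
  Q \is unitarymx -> E \is unitarymx ->
  (forall i j, (i <= j)%N -> b j <= b i) ->
  \sum_(j < k) qf (spec Q (fun i => b i)) (row j E) <= \sum_(i < k) b i.
Proof.
move=> uQ uE bm.
pose W := E *m Q^t*.
have uW : W \is unitarymx := mul_unitarymx uE (unitary_adj uQ).
have kn : (k <= n)%N by rewrite -(mxrank_unitary uE) rank_leq_col.
pose w i := \sum_j csq (W j i).
have EL : \sum_(j < k) qf (spec Q (fun i => b i)) (row j E) = \sum_(i < n) b i * w i.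
  under eq_bigr do rewrite qf_spec -row_mul.
  rewrite exchange_big; apply: eq_bigr => i _; rewrite mulr_sumr.
  by apply: eq_bigr => j _; rewrite mxE.
rewrite EL; apply: weighted_sum_ord_le => // [i|].
  rewrite sumr_ge0 => [|j _]; last exact: csq_ge0.
  have <- : qf 1%:M (delta_mx 0 i *m W^t*) = w i.
    rewrite qf1E; apply: eq_bigr => j _.
    by rewrite -rowE !mxE csq_conj.
  apply: le_trans (bessel _ uW) _; rewrite qf1E (bigD1 i) //= big1 ?addr0.
    by rewrite mxE !eqxx (csq_real 1) expr1n.
  by move=> j ji; rewrite mxE (negPf ji) andbF (csq_real 0) expr0n.
rewrite exchange_big /= -[k in RHS]card_ord -sumr_const.
apply: eq_bigr => j _; rewrite -(qf1_row j uW) qf1E.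
by apply: eq_bigr => i _; rewrite [X in _ = csq X]mxE.
Qed.

(** Split the inner sums at [k]. On the square of indices below [k] both sides agree by symmetry of
    [b]; on the rest j < k <= i, so [c j <= c i]. *)
Lemma sum_swap_le n k (c : 'I_n -> R) (b : 'I_n -> 'I_n -> R) :
  (forall i j : 'I_n, (i <= j)%N -> c i <= c j) ->
  (forall i j, 0 <= b i j) -> (forall i j, b i j = b j i) ->
  \sum_(j < n | (j < k)%N) c j * (\sum_i b j i) <=
  \sum_(j < n | (j < k)%N) \sum_i c i * b j i.
Proof.
move=> cm b0 bs.
pose S F := \sum_(j < n | (j < k)%N) \sum_(i < n | ~~ (i < k)%N) F j i : R.
pose S' F := \sum_(j < n | (j < k)%N) \sum_(i < n | (i < k)%N) F j i : R.
have split F : \sum_(j < n | (j < k)%N) \sum_i F j i = S' F + S F.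
  by rewrite -big_split; apply: eq_bigr => j _; rewrite (bigID (fun i : 'I_n => (i < k)%N)).
rewrite (eq_bigr (fun j => \sum_i c j * b j i)) => [|j _]; last by rewrite mulr_sumr.
rewrite !split.
have -> : S' (fun j i => c i * b j i) = S' (fun j i => c j * b j i).
  by rewrite /S' exchange_big; apply: eq_bigr => i _; apply: eq_bigr => j _; rewrite bs.
rewrite lerD2l; apply: ler_sum => j jk; apply: ler_sum => i ik.
rewrite ler_wpM2r // cm //; rewrite -leqNgt in ik.
exact: ltnW (leq_trans jk ik).
Qed.

Lemma powR_pred (x q : R) : 0 < x -> powR x q = x * powR x (- (1 - q)).
Proof.
move=> x0; have E : q = 1 + - (1 - q) by ring.
by rewrite {1}E powRD ?powRr1 ?(ltW x0) // (gt_eqF x0) implybT.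
Qed.

(** The shift by [e] makes negative powers of singular matrices available. This bound and
    [powR_shift_ge] show that it changes [x^q] by at most [e^q]. *)
Lemma powR_shift_le (x e q : R) : 0 <= x -> 0 < e -> q <= 1 ->
  x * powR (x + e) (- (1 - q)) <= powR x q.
Proof.
move=> x0 e0 q1; have [->|xn0] := eqVneq x 0; first by rewrite mul0r powR_ge0.
have xp : 0 < x by rewrite lt_def xn0.
rewrite (powR_pred q xp) ler_wpM2l // !powRN lef_pV2 ?posrE ?powR_gt0 ?addr_gt0 //.
by apply: ge0_ler_powR; rewrite ?nnegrE ?subr_ge0 ?addr_ge0 ?lerDl // ltW.
Qed.

Lemma powR_shift_ge (x e q : R) : 0 <= x -> 0 < e -> 0 < q <= 1 ->
  powR x q - powR e q <= x * powR (x + e) (- (1 - q)).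
Proof.
move=> x0 e0 /andP [q0 q1]; have xe : 0 < x + e by rewrite ltr_wpDl.
have -> : x * powR (x + e) (- (1 - q)) =
    powR (x + e) q - e * powR (x + e) (- (1 - q)).
  by rewrite (powR_pred q xe); ring.
rewrite (powR_pred q e0); apply: lerB.
  by apply: ge0_ler_powR; rewrite ?nnegrE ?(ltW q0) ?(ltW xe) ?lerDl // ltW.
rewrite ler_wpM2l ?(ltW e0) // !powRN lef_pV2 ?posrE ?powR_gt0 //.
by apply: ge0_ler_powR; rewrite ?nnegrE ?subr_ge0 ?(ltW xe) ?(ltW e0) ?lerDr.
Qed.

Lemma qf_spec_shift n (Q : 'M[C]_n) (l : 'I_n -> R) e v : Q \is unitarymx ->
  qf (spec Q (fun i => l i + e)) v = qf (spec Q l) v + e * qf 1%:M v.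
Proof.
move=> uQ; rewrite 2!qf_spec (qf1_unitaryE v uQ) mulr_sumr -big_split /=.
by apply: eq_bigr => i _; ring.
Qed.

(** Three moves: exchange the weight of the row index for that of the column index ([sum_swap_le]),
    replace the shifted power of [spec P la] by that of [spec Q mu] ([loewner_heinz_inv]), and
    compare commuting powers ([powR_shift_le]). *)
Lemma top_eigen_pow_le n k (Q P : 'M[C]_n) (mu la : 'I_n -> R) (q e : R) :
  Q \is unitarymx -> P \is unitarymx -> (forall i, 0 <= mu i) ->
  (forall i, 0 <= la i) -> (forall i j : 'I_n, (i <= j)%N -> la j <= la i) ->
  (forall v, qf (spec Q mu) v <= qf (spec P la) v) -> 0 < q <= 1 -> 0 < e ->
  \sum_(j < n | (j < k)%N) powR (la j + e) (- (1 - q)) * qf (spec Q mu) (row j P) <=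
  \sum_(j < n | (j < k)%N) qf (spec Q (fun i => powR (mu i) q)) (row j P).
Proof.
move=> uQ uP mu0 la0 lam h /andP [q0 q1] e0.
have r01 : 0 <= 1 - q <= 1 by rewrite subr_ge0 q1 lerBlDr lerDl ltW.
have mue i : 0 < mu i + e by rewrite ltr_wpDl.
have lae i : 0 < la i + e by rewrite ltr_wpDl.
pose H := spec Q (fun i => Num.sqrt (mu i)).
have H_adj : H^t* = H by exact: spec_adj.
have HH : spec Q mu = H *m 1%:M *m H^t*.
  by rewrite H_adj mulmx1 /H (spec_mul _ _ uQ); apply: eq_spec => i; rewrite -expr2 sqr_sqrtr.
(* Squared moduli of the entries of the root [H] in the eigenbasis [P]; [H] being Hermitian makes
   [b] symmetric. *)
pose b j i := csq ((P *m H *m P^t*) j i).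
have bs j i : b j i = b i j.
  have E : (P *m H *m P^t*)^t* = P *m H *m P^t* by rewrite !adjM trmxCK H_adj mulmxA.
  by rewrite /b -{1}E !mxE csq_conj.
have rE j i : (row j P *m H *m P^t*) 0 i = (P *m H *m P^t*) j i.
  by rewrite -!row_mul mxE.
have sb j : qf (spec Q mu) (row j P) = \sum_i b j i.
  rewrite HH qf_mul.
  rewrite -(qf_unitary _ (unitary_adj uP)) qf1E.
  by apply: eq_bigr => i _; rewrite rE.
under eq_bigr do rewrite sb.
apply: le_trans (sum_swap_le _ _ _ bs) _ => [i j ij|i j|].
- rewrite !powRN lef_pV2 ?posrE ?powR_gt0 //.
  by apply: ge0_ler_powR; rewrite ?nnegrE ?(ltW (lae _)) ?lerD2r ?lam //; case/andP: r01.
- exact: csq_ge0.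
apply: ler_sum => j _.
have -> : \sum_i powR (la i + e) (- (1 - q)) * b j i =
    qf (specpow P (fun i => la i + e) (- (1 - q))) (row j P *m H).
  by rewrite /specpow qf_spec; apply: eq_bigr => i _; rewrite rE.
apply: le_trans (loewner_heinz_inv uQ uP mue lae _ r01 _) _ => [v|].
  by rewrite (qf_spec_shift _ _ _ uQ) (qf_spec_shift _ _ _ uP) lerD2r h.
rewrite -qf_mul H_adj /H /specpow 2!(spec_mul _ _ uQ).
rewrite 2!qf_spec.
apply: ler_sum => i _.
rewrite ler_wpM2r ?csq_ge0 // mulrAC -expr2 sqr_sqrtr //.
exact: powR_shift_le.
Qed.

End KyFan.

(** * Weak majorization of sums of powers and its transport by a convex power *)

Section PowerMajorization.
Variable R : realType.
Local Notation C := R[i].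

(** Ky Fan for the sum of the powers is tested on the first [k] eigenvectors of the sum itself. Each
    summand is below that sum, so [top_eigen_pow_le] applies to it, and the error due to the shift
    is arbitrarily small. *)
Lemma sum_pow_ky_fan_le n m (Q : 'I_m -> 'M[C]_n) (mu : 'I_m -> 'I_n -> R)
    (P W : 'M[C]_n) (la be : nat -> R) (q : R) k :
  (forall l, Q l \is unitarymx) -> P \is unitarymx -> W \is unitarymx ->
  (forall l i, 0 <= mu l i) -> (forall i, 0 <= la i) ->
  (forall i j, (i <= j)%N -> la j <= la i) ->
  (forall i j, (i <= j)%N -> be j <= be i) ->
  \sum_l spec (Q l) (mu l) = spec P (fun i => la i) ->
  \sum_l spec (Q l) (fun i => powR (mu l i) q) = spec W (fun i => be i) ->
  0 < q <= 1 -> (k <= n)%N ->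
  \sum_(i < k) powR (la i) q <= \sum_(i < k) be i.
Proof.
move=> uQ uP uW mu0 la0 lam bem ES EB q01 kn.
have /andP [q0 q1] := q01.
pose E := rowsub (widen_ord kn) P.
have rE j : row j E = row (widen_ord kn j) P by apply/rowP => i; rewrite !mxE.
have uE : E \is unitarymx.
  apply/row_unitarymxP => i j; rewrite !rE dotmxE row_unitary //.
apply: le_trans (ky_fan uW uE bem); rewrite -EB.
under [X in _ <= X]eq_bigr do rewrite rE.
rewrite -(big_ord_narrow (F := fun j : 'I_n => qf _ (row j P)) kn).
rewrite -(big_ord_narrow (F := fun j : 'I_n => powR (la j) q) kn).
apply/ler_addgt0Pr => d d0.
(* Chosen so that [e^q] is [d / n.+1]: at most [n] error terms then add up to at most [d], and the
   divisor is nonzero even for [n = 0]. *)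
pose e := powR (d / n.+1%:R) q^-1.
have dn0 : 0 < d / n.+1%:R by rewrite divr_gt0 // ltr0Sn.
have e0 : 0 < e by rewrite powR_gt0.
have Eq : powR e q = d / n.+1%:R.
  by rewrite /e -powRrM mulVf ?gt_eqF // powRr1 // ltW.
have le_d : \sum_(j < n | (j < k)%N) powR e q <= d.
  apply: (@le_trans _ _ (\sum_(j < n) powR e q)).
    rewrite [X in _ <= X](bigID (fun j : 'I_n => (j < k)%N)) /= lerDl.
    by rewrite sumr_ge0 // => *; exact: powR_ge0.
  rewrite sumr_const card_ord Eq -[_ *+ n]mulr_natr mulrAC ler_pdivrMr ?ltr0Sn //.
  by rewrite ler_pM2l // ler_nat.
rewrite -lerBlDr; apply: le_trans (lerB (lexx _) le_d) _; rewrite -sumrB.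
apply: (@le_trans _ _ (\sum_(j < n | (j < k)%N)
    powR (la j + e) (- (1 - q)) * qf (spec P (fun i => la i)) (row j P))).
  apply: ler_sum => j _; rewrite qf_row_spec // mulrC.
  exact: powR_shift_ge.
under eq_bigr do rewrite -ES qf_sum mulr_sumr.
under [X in _ <= X]eq_bigr do rewrite qf_sum.
rewrite exchange_big [X in _ <= X]exchange_big; apply: ler_sum => l _.
apply: (@top_eigen_pow_le R n k _ _ _ (fun i => la i) _ _ (uQ l) uP (mu0 l)
  (fun i => la0 i) (fun i j => lam i j) _ q01 e0) => v.
rewrite -ES qf_sum (bigD1 l) //= lerDl sumr_ge0 // => i _.
by rewrite qf_spec sumr_ge0 // => j _; rewrite mulr_ge0 ?csq_ge0.
Qed.

(** Summation by parts: the left side is the boundary term, and the remaining terms are drops of [c]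
    times nonnegative partial sums. *)
Lemma abel_le n (c d : nat -> R) :
  (forall i j, (i <= j)%N -> c j <= c i) ->
  (forall k, (k <= n)%N -> 0 <= \sum_(i < k) d i) ->
  forall k, (k <= n)%N -> c k * \sum_(i < k) d i <= \sum_(i < k) c i * d i.
Proof.
move=> cm d0; elim=> [|k IH] kn; first by rewrite !big_ord0 mulr0.
apply: (@le_trans _ _ (c k * \sum_(i < k.+1) d i)).
  by rewrite ler_wpM2r ?d0 // cm.
by rewrite !big_ord_recr /= mulrDr lerD2r IH // ltnW.
Qed.

(** Two instances of 1 + x <= exp x, at (1 - q) ln y and at - q ln y, are averaged with weights [q]
    and [1 - q]; the logarithms cancel. *)
Lemma powR_le_affine (y q : R) : 0 < y -> 0 <= q <= 1 ->
  powR y q <= q * y + (1 - q).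
Proof.
move=> y0 /andP [q0 q1]; rewrite /powR gt_eqF //.
set E := expR (q * ln y).
have E0 : 0 < E by exact: expR_gt0.
have h1 : E * (1 + (1 - q) * ln y) <= y.
  apply: (@le_trans _ _ (E * expR ((1 - q) * ln y))).
    by rewrite ler_pM2l // expR_ge1Dx.
  rewrite /E -expRD (_ : q * ln y + (1 - q) * ln y = ln y); last by ring.
  by rewrite lnK.
have h2 : E * (1 - q * ln y) <= 1.
  apply: (@le_trans _ _ (E * expR (- (q * ln y)))).
    by rewrite ler_pM2l // expR_ge1Dx.
  by rewrite /E -expRD subrr expR0.
have -> : E = q * (E * (1 + (1 - q) * ln y)) + (1 - q) * (E * (1 - q * ln y)) by ring.
have q1' : 0 <= 1 - q by rewrite subr_ge0.
apply: lerD; first by rewrite ler_wpM2l.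
by rewrite -[X in _ <= X]mulr1 ler_wpM2l.
Qed.

(** Convexity of x^(1/q): its graph lies above the tangent at a^q, whose slope is a^(1-q) / q.
    Dividing by [a] reduces this to [powR_le_affine] at b/a. *)
Lemma powR_tangent (a b q : R) : 0 <= a -> 0 <= b -> 0 < q <= 1 ->
  q^-1 * powR a (1 - q) * (powR b q - powR a q) <= b - a.
Proof.
move=> a0 b0 /andP [q0 q1].
have qn0 : q != 0 by rewrite gt_eqF.
have [->|an0] := eqVneq a 0.
  rewrite (powR0 qn0) !subr0.
  (* At [a = 0] the slope vanishes unless [q = 1], where the convention 0^0 = 1 makes it 1. *)
  have [->|qn1] := eqVneq q 1; first by rewrite subrr powRr0 invr1 !mul1r powRr1.
  by rewrite powR0 ?mulr0 ?mul0r // subr_eq0 eq_sym.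
have ap : 0 < a by rewrite lt_def an0.
have Ea : powR a (1 - q) * powR a q = a.
  by rewrite -powRD ?an0 ?implybT // subrK powRr1.
rewrite mulrBr -[_ * powR a q]mulrA Ea.
have [->|bn0] := eqVneq b 0.
  rewrite powR0 // mulr0 lerB // -[X in X <= _]mul1r ler_pM2r //.
  by rewrite invf_ge1.
have bp : 0 < b by rewrite lt_def bn0.
have := powR_le_affine (divr_gt0 bp ap) (_ : 0 <= q <= 1).
rewrite (ltW q0) q1 => /(_ isT).
set Y := powR (b / a) q => hY.
have -> : powR b q = Y * powR a q.
  by rewrite /Y -powRM ?divfK // ?ltW // divr_gt0.
rewrite mulrA -(mulrA q^-1) (mulrC (powR a _)) -!mulrA Ea.
have -> : q^-1 * (Y * a) - q^-1 * a = q^-1 * a * (Y - 1) by ring.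
have -> : b - a = q^-1 * a * (q * (b / a) + (1 - q) - 1).
  by field; rewrite qn0 an0.
by rewrite ler_wpM2l ?lerB // mulr_ge0 // invr_ge0 ltW.
Qed.

(** Tangents at the points [la i ^ q] bound the difference below by the sum of [c i * d i]; the
    slopes [c i] are nonincreasing and nonnegative, so [abel_le] makes this sum nonnegative. *)
Lemma powR_weak_major n (la be : nat -> R) (q : R) : 0 < q <= 1 ->
  (forall i j, (i <= j)%N -> la j <= la i) -> (forall i, 0 <= la i) ->
  (forall i, 0 <= be i) ->
  (forall k, (k <= n)%N -> \sum_(i < k) powR (la i) q <= \sum_(i < k) be i) ->
  forall k, (k <= n)%N -> \sum_(i < k) la i <= \sum_(i < k) powR (be i) q^-1.
Proof.
move=> q01 lam la0 be0 h k kn; have /andP [q0 q1] := q01.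
pose c i := q^-1 * powR (la i) (1 - q).
have cm i j : (i <= j)%N -> c j <= c i.
  move=> ij; rewrite ler_wpM2l ?invr_ge0 ?(ltW q0) //.
  by apply: ge0_ler_powR; rewrite ?nnegrE ?subr_ge0 ?lam.
pose d i := be i - powR (la i) q.
have d0 j : (j <= n)%N -> 0 <= \sum_(i < j) d i.
  by move=> jn; rewrite sumrB subr_ge0 h.
rewrite -subr_ge0 -sumrB.
apply: (@le_trans _ _ (\sum_(i < k) c i * d i)).
  apply: le_trans (abel_le cm d0 kn); rewrite mulr_ge0 ?d0 //.
  by rewrite mulr_ge0 ?powR_ge0 // invr_ge0 ltW.
apply: ler_sum => i _; rewrite /c /d.
have {1}-> : be i = powR (powR (be i) q^-1) q.
  by rewrite -powRrM mulVf ?gt_eqF // powRr1.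
by apply: powR_tangent => //; exact: powR_ge0.
Qed.

End PowerMajorization.

(** * Weak majorization of the singular values of a sum of normal matrices *)

Section Triangle.
Variable R : realType.
Local Notation C := R[i].

(** Here [a] is the modulus of [z]. Multiplied by [a], the difference of the two sides is |a y - z
    x|^2. *)
Lemma Re_mul3_le (x y z : C) (a : R) : 0 <= a -> a ^+ 2 = csq z ->
  2 * complex.Re (x * z * (y^*)%R) <= a * (csq x + csq y).
Proof.
move=> a0 Ea; have [a_eq0|an0] := eqVneq a 0.
  have /csq_eq0 -> : csq z = 0 by rewrite -Ea a_eq0 expr0n.
  by rewrite mulr0 mul0r a_eq0 !mul0r /= mulr0.
have ap : 0 < a by rewrite lt_def an0.
rewrite -(ler_pM2l ap) -subr_ge0.
suff -> : a * (a * (csq x + csq y)) - a * (2 * complex.Re (x * z * (y^*)%R)) =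
  csq (a%:C * y - z * x) by exact: csq_ge0.
move: Ea; case: x y z => [x1 x2] [y1 y2] [z1 z2]; rewrite /csq /= => Ea.
have -> : a * (a * (x1 ^+ 2 + x2 ^+ 2 + (y1 ^+ 2 + y2 ^+ 2))) =
  a ^+ 2 * (x1 ^+ 2 + x2 ^+ 2 + (y1 ^+ 2 + y2 ^+ 2)) by ring.
rewrite mulrDr {1}Ea; ring.
Qed.

Lemma adj_mul_herm n (A : 'M[C]_n) : A^t* *m A \is hermsymmx.
Proof. by apply/hermP; rewrite adjM trmxCK. Qed.

(** Normality gives [A] and its absolute value a common eigenbasis, so the inequality reduces to
    [Re_mul3_le] in each coordinate. *)
Lemma normal_mxabs n (A : 'M[C]_n) : A \is normalmx ->
  exists Q (mu : 'I_n -> R), [/\ Q \is unitarymx, forall i, 0 <= mu i,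
    mxabs A = spec Q mu & forall u v,
    2 * complex.Re ((u *m A *m v^t*) 0 0) <= qf (mxabs A) u + qf (mxabs A) v].
Proof.
move=> nA; pose Q := spectralmx A; pose z i := spectral_diag A 0 i.
have uQ : Q \is unitarymx by exact: spectral_unitarymx.
have EA : A = Q^t* *m diag_mx (spectral_diag A) *m Q.
  by rewrite -(invmx_unitary uQ); exact: (orthomx_spectralP nA).
have K (X : 'M_n) : Q *m (Q^t* *m X) = X.
  by rewrite mulmxA (unitarymxP uQ) mul1mx.
have EAA : A^t* *m A = spec Q (fun i => csq (z i)).
  rewrite EA 2!adjM trmxCK -!mulmxA K specE -!mulmxA.
  rewrite tr_diag_mx map_diag_mx (mulmxA (diag_mx _) (diag_mx _)) mulmx_diag.
  suff -> : \row_j ((map_mx Num.conj (spectral_diag A)) 0 j * (spectral_diag A) 0 j) =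
    \row_i (csq (z i))%:C by [].
  by apply/rowP => i; rewrite !mxE csqE mulrC.
pose mu i := powR (csq (z i)) 2%:R^-1.
have mu0 i : 0 <= mu i by exact: powR_ge0.
have mu2 i : mu i ^+ 2 = csq (z i).
  by rewrite /mu powR12_sqrt ?csq_ge0 // sqr_sqrtr // csq_ge0.
have Eabs : mxabs A = spec Q mu.
  by rewrite /mxabs /mxpow EAA; exact: mxfunE.
exists Q, mu; split=> // u v.
rewrite Eabs !qf_spec.
have -> : (u *m A *m v^t*) 0 0 =
    \sum_i (u *m Q^t*) 0 i * z i * (((v *m Q^t*) 0 i)^*)%R.
  have -> : u *m A *m v^t* = (u *m Q^t*) *m diag_mx (spectral_diag A) *m (v *m Q^t*)^t*.
    by rewrite adjM trmxCK {1}EA !mulmxA.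
  rewrite mul_mx_diag mxE; apply: eq_bigr => i _.
  by rewrite !mxE.
rewrite Re_sum mulr_sumr -big_split /=; apply: ler_sum => i _.
by rewrite -mulrDr Re_mul3_le.
Qed.

Lemma mxabs_sorted n (T : 'M[C]_n) :
  exists V (s : nat -> R), [/\ V \is unitarymx, forall i j, (i <= j)%N -> s j <= s i,
    forall i, 0 <= s i, mxabs T = spec V (fun i => s i) &
    T^t* *m T = spec V (fun i => s i ^+ 2)].
Proof.
have [v|V [t [uV tm t0 E]]] := psd_sorted_spectral (adj_mul_herm T).
  suff -> : qf (T^t* *m T) v = qf 1%:M (v *m T^t*) by exact: qf1_ge0.
  by rewrite -qf_mul mulmx1 trmxCK.
exists V, (fun i => powR (t i) 2%:R^-1); split.
- exact: uV.
- move=> i j ij; apply: ge0_ler_powR; rewrite ?nnegrE ?invr_ge0 ?ler0n ?t0 //.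
  exact: tm.
- by move=> i; exact: powR_ge0.
- by rewrite /mxabs /mxpow E; exact: mxfunE.
- by rewrite E; apply: eq_spec => i; rewrite powR12_sqrt // sqr_sqrtr.
Qed.

(* For [s j > 0], the vectors [w_j = v_j T^* / s j] are orthonormal with
   [<w_j, T v_j> = s j]: they replace the polar decomposition of [T]. *)
Lemma weak_major_of_sesqui_le n (T V P : 'M[C]_n) (s la : nat -> R) :
  V \is unitarymx -> P \is unitarymx ->
  (forall i j, (i <= j)%N -> s j <= s i) -> (forall i, 0 <= s i) ->
  (forall i j, (i <= j)%N -> la j <= la i) -> (forall i, 0 <= la i) ->
  T^t* *m T = spec V (fun i => s i ^+ 2) ->
  (forall u v, 2 * complex.Re ((u *m T *m v^t*) 0 0) <=
     qf (spec P (fun i => la i)) u + qf (spec P (fun i => la i)) v) ->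
  forall k, (k <= n)%N -> \sum_(i < k) s i <= \sum_(i < k) la i.
Proof.
move=> uV uP sm s0 lam la0 ET hT; elim=> [|k IH] kn; first by rewrite !big_ord0.
(* A zero [s k] adds nothing on the left, so the previous case suffices. Otherwise all [s j] with j
   <= k are positive and may be inverted. *)
have [sk0|skn0] := eqVneq (s k) 0.
  by rewrite !big_ord_recr /= sk0 lerD ?IH // ltnW.
have sk : 0 < s k by rewrite lt_def skn0 s0.
have sp (j : 'I_k.+1) : 0 < s j.
  by apply: lt_le_trans sk _; apply: sm; rewrite -ltnS.
pose v (j : 'I_k.+1) := row (widen_ord kn j) V.
have vT i j : (v i *m T^t* *m T *m (v j)^t*) 0 0 = (s i ^+ 2)%:C * (i == j)%:R.
  rewrite -(mulmxA (v i)) ET mul_row_spec // -scalemxAl mxE row_unitary //.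
pose w (j : 'I_k.+1) := ((s j)^-1)%:C *: (v j *m T^t*).
have wT j : (w j *m T *m (v j)^t*) 0 0 = (s j)%:C.
  rewrite /w -!scalemxAl mxE vT eqxx mulr1 -rmorphM /=; congr (_%:C).
  by field; rewrite gt_eqF.
pose E1 := \matrix_(j < k.+1) w j; pose E2 := \matrix_(j < k.+1) v j.
have uE1 : E1 \is unitarymx.
  apply/row_unitarymxP => i j; rewrite dotmxE !rowK /w adjZ -scalemxAl -scalemxAr.
  rewrite scalerA mxE adjM trmxCK mulmxA vT.
  have [->|_] := eqVneq i j; last by rewrite !mulr0.
  have -> : ((s j)^-1%:C)^*%R = (s j)^-1%:C by exact: conjc_real.
  rewrite mulr1 -!rmorphM /= (_ : _ * _ = 1) //.
  by field; rewrite gt_eqF.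
have uE2 : E2 \is unitarymx.
  by apply/row_unitarymxP => i j; rewrite dotmxE !rowK row_unitary.
have k1 := ky_fan uP uE1 lam; have k2 := ky_fan uP uE2 lam.
rewrite -(ler_pM2l (ltr0Sn R 1)) mulr_sumr.
apply: (@le_trans _ _ (\sum_(j < k.+1) (qf (spec P (fun i => la i)) (row j E1) +
   qf (spec P (fun i => la i)) (row j E2)))).
  apply: ler_sum => j _; rewrite !rowK; apply: le_trans (hT _ _).
  by rewrite wT.
rewrite big_split /= mulrDl mul1r; exact: lerD.
Qed.

End Triangle.

(** * Horn's theorem: a prescribed lower bound for a diagonal *)

Section Horn.
Variable R : realType.
Local Notation C := R[i].

(* The entries [y a >= s 0 > y a.+1] are rotated into [s 0], which is removed,
   and [y a + y a.+1 - s 0]; if all [y i >= s 0], the last one is removed. *)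
Lemma horn_step n (s y : nat -> R) :
  (forall i j, (i <= j)%N -> s j <= s i) -> (forall i j, (i <= j)%N -> y j <= y i) ->
  (forall k, (k <= n.+1)%N -> \sum_(i < k) s i <= \sum_(i < k) y i) ->
  exists a (c d : R) (y' : nat -> R),
  [/\ (a <= n)%N /\ ((a < n)%N \/ d = 0), c ^+ 2 + d ^+ 2 = 1,
      s 0%N <= c ^+ 2 * y a + d ^+ 2 * y a.+1,
      forall i, y' i = if (i < a)%N then y i else
        if i == a then d ^+ 2 * y a + c ^+ 2 * y a.+1 else y i.+1 &
      (forall i j, (i <= j)%N -> y' j <= y' i) /\
      forall k, (k <= n)%N -> \sum_(i < k) s i.+1 <= \sum_(i < k) y' i].
Proof.
move=> sm ym h.
(* The index to rotate is the largest one satisfying [p]; the hypothesis for one-term sums shows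
   that 0 satisfies it. *)
pose p a := (a <= n)%N && (s 0%N <= y a).
have p0 : exists a, p a.
  by exists 0%N; rewrite /p /=; have := h 1%N isT; rewrite !big_ord1.
have pn a : p a -> (a <= n)%N by case/andP.
have [a /andP [an sa] amax] := ex_maxnP p0 pn.
have [c [d [cd dn z0 z1]]] : exists c d : R, [/\ c ^+ 2 + d ^+ 2 = 1,
    (a < n)%N \/ d = 0, s 0%N <= c ^+ 2 * y a + d ^+ 2 * y a.+1 &
    (a < n)%N -> c ^+ 2 * y a + d ^+ 2 * y a.+1 = s 0%N].
  have [alt|age] := ltnP a n; last first.
    exists 1, 0; split; rewrite ?expr1n ?expr0n ?addr0 //=; first by right.
    by rewrite mul0r addr0 mul1r.
  have lt : y a.+1 < s 0%N.
    rewrite ltNge; apply/negP => ge.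
    by have := amax a.+1; rewrite /p alt ge ltnn => /(_ isT).
  have ab : 0 < y a - y a.+1 by rewrite subr_gt0; exact: lt_le_trans sa.
  (* The barycentric coordinate of [s 0] between [y a.+1] and [y a]; its root and that of [1 - t]
     are the cosine and sine of the rotation. *)
  pose t := (s 0%N - y a.+1) / (y a - y a.+1).
  have t0 : 0 <= t by rewrite divr_ge0 ?ltW // subr_gt0.
  have t1 : t <= 1 by rewrite ler_pdivrMr // mul1r lerB.
  have e : t * y a + (1 - t) * y a.+1 = s 0%N.
    by rewrite /t; field; rewrite gt_eqF.
  exists (Num.sqrt t), (Num.sqrt (1 - t)).
  rewrite !sqr_sqrtr ?subr_ge0 // e; split => //; first by ring.
  by left.
have c2 := sqr_ge0 c; have d2 := sqr_ge0 d.
pose y' i := if (i < a)%N then y i else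
  if i == a then d ^+ 2 * y a + c ^+ 2 * y a.+1 else y i.+1.
exists a, c, d, y'; split => //; split.
  have rf (x : R) : x >= x by [].
  have tr (u v w : R) : v >= u -> u >= w -> v >= w by move=> h1 h2; exact: le_trans h1.
  have ya := ym _ _ (leqnSn a).
  have dE : d ^+ 2 = 1 - c ^+ 2 by rewrite -cd; ring.
  have cE : c ^+ 2 = 1 - d ^+ 2 by rewrite -cd; ring.
  have ta : d ^+ 2 * y a + c ^+ 2 * y a.+1 <= y a.
    rewrite -subr_ge0 dE (_ : _ - _ = c ^+ 2 * (y a - y a.+1)); last by ring.
    by rewrite mulr_ge0 ?subr_ge0.
  have tb : y a.+1 <= d ^+ 2 * y a + c ^+ 2 * y a.+1.
    rewrite -subr_ge0 cE (_ : _ - _ = d ^+ 2 * (y a - y a.+1)); last by ring.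
    by rewrite mulr_ge0 ?subr_ge0.
  suff mono i : y' i.+1 <= y' i.
    by move=> i j ij; apply: (homo_leq rf tr (f := y')).
  rewrite /y'; case: (ltngtP i.+1 a) => ia.
  - exact: ym.
  - case: eqP => [->|_]; last exact: ym.
    by apply: le_trans tb; rewrite ?ym.
  - by apply: le_trans ta _; rewrite -ia ym.
move=> k kn; have [ka|ka] := leqP k a.
  apply: ler_sum => i _; have ia := leq_trans (ltn_ord i) ka.
  rewrite /y' ia; apply: le_trans (sm _ _ (leq0n _)) (le_trans sa _).
  exact/ym/ltnW.
have an' := leq_trans ka kn.
(* The rotation preserves [y a + y a.+1], so discarding [s 0] lowers the partial sums past [a] by
   exactly that amount; a < k <= n excludes the unrotated case. *)
have E : \sum_(i < k) y' i = \sum_(i < k.+1) y i - s 0%N.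
  rewrite -(z1 an') -(subnKC ka); elim: (k - a.+1)%N => [|j IH].
    rewrite addn0 !big_ord_recr /= (eq_bigr (fun i : 'I_a => y i)) => [|i _].
      rewrite /y' ltnn eqxx.
      have -> : d ^+ 2 = 1 - c ^+ 2 by rewrite -cd; ring.
      by ring.
    by rewrite /y' ltn_ord.
  rewrite addnS big_ord_recr IH [in RHS]big_ord_recr /= /y'.
  have -> : (a.+1 + j < a)%N = false by lia.
  have -> : (a.+1 + j == a)%N = false by lia.
  by ring.
rewrite E lerBrDl; have := h k.+1 kn.
by rewrite [X in X <= _]big_ord_recl.
Qed.

(** One sesquilinear form expresses both orthonormality ([B] the identity) and diagonality of [Y] on
    a family of vectors. *)
Definition frm n (B : 'M[C]_n) (u v : 'rV[C]_n) : C := (u *m B *m v^t*) 0 0.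

Lemma frm_combl n (B : 'M[C]_n) (a b : R) (u v t : 'rV[C]_n) :
  frm B (a%:C *: u + b%:C *: v) t = a%:C * frm B u t + b%:C * frm B v t.
Proof.
rewrite /frm !mulmxDl -!scalemxAl.
by move: (u *m B *m t^t*) (v *m B *m t^t*) => X Y; rewrite !mxE.
Qed.

Lemma frm_combr n (B : 'M[C]_n) (a b : R) (u v t : 'rV[C]_n) :
  frm B t (a%:C *: u + b%:C *: v) = a%:C * frm B t u + b%:C * frm B t v.
Proof.
have J (x : R) : (x%:C)^*%R = x%:C by exact: conjc_real.
rewrite /frm adjD !adjZ !J !mulmxDr -!scalemxAr.
by move: (t *m B *m u^t*) (t *m B *m v^t*) => X Y; rewrite !mxE.
Qed.

Lemma frm_comb n (B : 'M[C]_n) (a b a' b' : R) (u v u' v' : 'rV[C]_n) :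
  frm B (a%:C *: u + b%:C *: v) (a'%:C *: u' + b'%:C *: v') =
  (a * a')%:C * frm B u u' + (a * b')%:C * frm B u v' +
  (b * a')%:C * frm B v u' + (b * b')%:C * frm B v v'.
Proof.
rewrite frm_combl !frm_combr !rmorphM /=.
by move: (frm B u u') (frm B u v') (frm B v u') (frm B v v') => X Y Z T; ring.
Qed.

Lemma frm_conj n (u v : 'rV[C]_n) : frm 1%:M u v = ((frm 1%:M v u)^*)%R.
Proof.
rewrite /frm !mulmx1 -[u in LHS]trmxCK -adjM.
by rewrite [LHS]mxE mxE.
Qed.

(** Induction on the size [n] of the family inside a fixed ambient space. [horn_step] splits off a
    unit vector for [s 0] and leaves [n] vectors on which [Y] is diagonal with entries [y']. The
    clause on [u] says that [z] stays in the span of [x], so later vectors are orthogonal to the one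
    split off. *)
Lemma weak_horn n N (Y : 'M[C]_N) (x : nat -> 'rV[C]_N) (s y : nat -> R) :
  (forall i j, (i <= j)%N -> s j <= s i) -> (forall i j, (i <= j)%N -> y j <= y i) ->
  (forall k, (k <= n)%N -> \sum_(i < k) s i <= \sum_(i < k) y i) ->
  (forall i j, (i < n)%N -> (j < n)%N -> frm 1%:M (x i) (x j) = (i == j)%:R) ->
  (forall i j, (i < n)%N -> (j < n)%N -> frm Y (x i) (x j) = (y i)%:C * (i == j)%:R) ->
  exists z : nat -> 'rV[C]_N,
  [/\ forall i j, (i < n)%N -> (j < n)%N -> frm 1%:M (z i) (z j) = (i == j)%:R,
      forall u, (forall j, (j < n)%N -> frm 1%:M (x j) u = 0) ->
        forall i, (i < n)%N -> frm 1%:M (z i) u = 0 &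
      forall i, (i < n)%N -> s i <= qf Y (z i)].
Proof.
elim: n x s y => [|n IH] x s y sm ym h xo xY; first by exists x; split.
have [a [c [d [y' [[an dn] cd z0 y'E [y'm y'h]]]]]] := horn_step sm ym h.
(* With these coefficients [x' i] is [x i] before [a], the rotated vector - d x_a + c x_(a+1) at
   [a], and [x i.+1] afterwards. *)
pose p i : R := if (i < a)%N then 1 else if i == a then - d else 0.
pose r i : R := if (i < a)%N then 0 else if i == a then c else 1.
pose x' i := (p i)%:C *: x i + (r i)%:C *: x i.+1.
have pr i : p i ^+ 2 + r i ^+ 2 = 1.
  rewrite /p /r; case: ltnP => _; first by rewrite expr1n expr0n addr0.
  by case: eqP => _; rewrite ?sqrrN ?[d ^+ 2 + _]addrC // expr1n expr0n add0r.
(* Stated for any [B] diagonal on [x], to serve both for the identity and for [Y]. *)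
have x'B B (w : nat -> R) :
    (forall i j, (i < n.+1)%N -> (j < n.+1)%N -> frm B (x i) (x j) = (w i)%:C * (i == j)%:R) ->
    forall i j, (i < n)%N -> (j < n)%N -> frm B (x' i) (x' j) =
      (p i ^+ 2 * w i + r i ^+ 2 * w i.+1)%:C * (i == j)%:R.
  move=> H i j ilt jlt; rewrite /x' frm_comb !H ?ltnS // 1?ltnW //.
  rewrite eqSS; have [<-|ij] := eqVneq i j.
    rewrite (eqn_leq i i.+1) (eqn_leq i.+1 i) ltnn leqnSn /= !mulr0 !addr0 !mulr1.
    by rewrite -!rmorphM -rmorphD /=; congr (_%:C); ring.
  rewrite !mulr0.
  have -> : (p i * r j)%:C * ((w i)%:C * (i == j.+1)%:R) = 0 :> C.
    case: eqP => [e|_]; last by rewrite !mulr0.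
    rewrite (_ : p i * r j = 0) ?mul0r // /p /r e.
    have [ja|ja] := ltnP j a; first by rewrite mulr0.
    have -> : (j.+1 < a)%N = false by lia.
    have -> : (j.+1 == a)%N = false by lia.
    by rewrite mul0r.
  have -> : (r i * p j)%:C * ((w i.+1)%:C * (i.+1 == j)%:R) = 0 :> C.
    case: eqP => [e|_]; last by rewrite !mulr0.
    rewrite (_ : r i * p j = 0) ?mul0r // /p /r -e.
    have [ia|ia] := ltnP i a; first by rewrite mul0r.
    have -> : (i.+1 < a)%N = false by lia.
    have -> : (i.+1 == a)%N = false by lia.
    by rewrite mulr0.
  by rewrite !addr0.
have x'o i j : (i < n)%N -> (j < n)%N -> frm 1%:M (x' i) (x' j) = (i == j)%:R.
  move=> ilt jlt; rewrite (x'B _ (fun=> 1)) // ?mulr1 ?pr ?mul1r //.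
  by move=> i' j' h1 h2; rewrite xo // mul1r.
have x'Y i j : (i < n)%N -> (j < n)%N -> frm Y (x' i) (x' j) = (y' i)%:C * (i == j)%:R.
  move=> ilt jlt; rewrite (x'B _ y) //; congr (_%:C * _); rewrite y'E /p /r.
  case: ltnP => _; first by rewrite expr1n expr0n mul1r mul0r addr0.
  case: eqP => [->|_]; first by rewrite sqrrN.
  by rewrite expr1n expr0n mul1r mul0r add0r.
have sSm i j : (i <= j)%N -> s j.+1 <= s i.+1 by move=> ij; apply: sm.
have [z [zo zx zs]] := IH x' (fun i => s i.+1) y' sSm y'm y'h x'o x'Y.
(* The vector assigned to [s 0]. When [a = n] the vector [x a.+1] lies outside the family, but then
   [d = 0]. *)
pose w := c%:C *: x a + d%:C *: x a.+1.
have frmw B (t : nat -> R) : (forall i j, (i < n.+1)%N -> (j < n.+1)%N ->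
    frm B (x i) (x j) = (t i)%:C * (i == j)%:R) ->
    frm B w w = (c ^+ 2 * t a + d ^+ 2 * t a.+1)%:C.
  move=> H; rewrite /w frm_comb; case: dn => [alt|->].
    rewrite !H ?ltnS // !eqxx (eqn_leq a a.+1) (eqn_leq a.+1 a) ltnn leqnSn /=.
    by rewrite !mulr1 !mulr0 !addr0 -!rmorphM -rmorphD.
  by rewrite !mulr0 !mul0r !addr0 H ?ltnS // eqxx mulr1 -rmorphM expr0n mul0r addr0.
have x'w j : (j < n)%N -> frm 1%:M (x' j) w = 0.
  move=> jn; rewrite /x' /w frm_comb.
  have -> : (p j * d)%:C * frm 1%:M (x j) (x a.+1) = (p j * d)%:C * (j == a.+1)%:R.
    by case: dn => [alt|->]; [rewrite xo ?ltnS // ltnW | rewrite mulr0 !mul0r].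
  have -> : (r j * d)%:C * frm 1%:M (x j.+1) (x a.+1) = (r j * d)%:C * (j == a)%:R.
    by case: dn => [alt|->]; [rewrite xo ?ltnS | rewrite mulr0 !mul0r].
  rewrite !xo ?ltnS // 1?ltnW // /p /r.
  have [->|ja] := eqVneq j a.
    rewrite ltnn ?eqxx (eqn_leq a a.+1) (eqn_leq a.+1 a) ltnn leqnSn /=.
    rewrite !mulr0 !mulr1 !addr0 -rmorphD /=.
    by rewrite (_ : _ + _ = 0) //; ring.
  have [ja'|ja'] := ltnP j a.
    have -> : (j == a.+1)%N = false by lia.
    by rewrite !mulr0 !mul0r ?mulr0 ?mul0r ?addr0.
  have -> : (j.+1 == a)%N = false by lia.
  by rewrite !mulr0 !mul0r ?mulr0 ?mul0r ?addr0.
have w1 : frm 1%:M w w = 1.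
  rewrite (frmw _ (fun=> 1)) ?mulr1 ?cd // => i j h1 h2.
  by rewrite xo // mul1r.
have zw i : (i < n)%N -> frm 1%:M (z i) w = 0 by apply: zx.
exists (fun i => if i is j.+1 then z j else w); split.
- move=> [|i] [|j]; rewrite ?ltnS => h1 h2.
  + exact: w1.
  + by rewrite frm_conj zw // conjC0.
  + exact: zw.
  + exact: zo.
- move=> u xu.
  have xu' j : (j < n)%N -> frm 1%:M (x' j) u = 0.
    by move=> jn; rewrite frm_combl !xu ?mulr0 ?addr0 // ltnW.
  move=> [_|i] //; last exact: zx.
  rewrite /w frm_combl xu // mulr0 add0r.
  by case: dn => [alt|->]; [rewrite xu ?mulr0 | rewrite mul0r].
- move=> [_|i] //; last exact: zs.
  by apply: le_trans z0 _; rewrite /qf -/(frm Y w w) (frmw _ y).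
Qed.

End Horn.

(** * The diagonal part as an average of unitary conjugates *)

Section Pinching.
Variable R : realType.
Local Notation C := R[i].

(** X^n - 1 splits and is separable in characteristic 0, so it has [n] distinct roots, among which
    one is primitive. *)
Lemma prim_root_exists (F : numClosedFieldType) n : (n > 0)%N ->
  exists z : F, n.-primitive_root z.
Proof.
move=> n_gt0; pose p : {poly F} := 'X^n - 1.
have [r Dp] := closed_field_poly_normal p.
rewrite (monicP _) ?monicXnsubC // scale1r in Dp.
have rn1 : all n.-unity_root r by apply/allP => z; rewrite -root_prod_XsubC -Dp.
have sz_r : (n < (size r).+1)%N by rewrite -(size_prod_XsubC r id) -Dp size_XnsubC.
have [|z] := hasP (has_prim_root n_gt0 rn1 _ sz_r); last by exists z.
by rewrite -separable_prod_XsubC -Dp separable_Xn_sub_1 // pnatr_eq0 -lt0n.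
Qed.

(** Since [om] has modulus 1, the base of the powers is an [n]-th root of unity, different from 1
    when i and j differ; the geometric sum then vanishes. *)
Lemma sum_prim_root_expr n (om : C) (i j : 'I_n) : n.-primitive_root om ->
  \sum_(l < n) (om ^+ i * (om ^+ j)^*%R) ^+ l = n%:R * (i == j)%:R.
Proof.
move=> prim; have n0 := prim_order_gt0 prim.
have om1 : om * om^*%R = 1.
  have : `|om| ^+ n == 1 by rewrite -normrX (prim_expr_order prim) normr1.
  by rewrite pexpr_eq1 // => /eqP e; rewrite -normCK e expr1n.
have omk k : om ^+ k * (om ^+ k)^*%R = 1 by rewrite rmorphXn -exprMn om1 expr1n.
have [<-|ij] := eqVneq i j.
  by rewrite omk mulr1 (eq_bigr (fun=> 1)) ?sumr_const ?card_ord // => l _; rewrite expr1n.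
rewrite mulr0; set rho := _ * _.
have rhon : rho ^+ n = 1.
  rewrite /rho exprMn -rmorphXn -!exprM !(mulnC _ n) !exprM (prim_expr_order prim).
  by rewrite !expr1n rmorph1 mulr1.
have rho1 : rho != 1.
  apply: contra ij => /eqP e; rewrite -val_eqE /=.
  have : om ^+ i == om ^+ j.
    by rewrite -[om ^+ i]mulr1 -(omk j) [_ ^+ j * _]mulrC mulrA -/rho e mul1r.
  by rewrite (eq_prim_root_expr prim) !modn_small.
have := subrX1 rho n; rewrite rhon subrr => /esym/eqP.
by rewrite mulf_eq0 subr_eq0 (negPf rho1) /= => /eqP.
Qed.

(** Conjugation by the [l]-th power of the diagonal matrix of the [om ^+ i] multiplies the entry (i,
    j) by the [l]-th term of that geometric sum, so averaging kills exactly the off-diagonal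
    entries. *)
Lemma pinching n : (n > 0)%N -> exists D : 'I_n -> 'M[C]_n,
  (forall l, D l \is unitarymx) /\
  forall G : 'M[C]_n, (n%:R : C)^-1 *: \sum_l (D l *m G *m (D l)^t*) =
    diag_mx (\row_i G i i).
Proof.
move=> n0; have [om prim] := prim_root_exists C n0.
have om1 k : om ^+ k * (om ^+ k)^*%R = 1.
  have : `|om| ^+ n == 1 by rewrite -normrX (prim_expr_order prim) normr1.
  rewrite pexpr_eq1 // => /eqP e.
  by rewrite rmorphXn -exprMn -normCK e !expr1n.
have DT (v : 'rV[C]_n) : (diag_mx v)^t* = diag_mx (map_mx Num.conj v).
  by rewrite tr_diag_mx map_diag_mx.
exists (fun l => diag_mx (\row_i om ^+ (i * l))); split=> [l|G].
  apply/unitarymxP; rewrite DT mulmx_diag -diag_const_mx.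
  suff -> : \row_j ((\row_i om ^+ (i * l)) 0 j *
     (map_mx Num.conj (\row_(i < n) om ^+ (i * l))) 0 j) = const_mx 1 by [].
  by apply/rowP => i; rewrite !mxE om1.
apply/matrixP => i j; rewrite [LHS]mxE summxE.
rewrite (eq_bigr (fun l : 'I_n => G i j * (om ^+ i * (om ^+ j)^*%R) ^+ l)) => [|l _].
  rewrite -mulr_sumr sum_prim_root_expr // mulrCA mulKf ?pnatr_eq0 -?lt0n //.
  by rewrite !mxE mulr_natr; case: eqP => [->|_].
rewrite DT mul_mx_diag mxE mul_diag_mx !mxE exprMn -rmorphXn -!exprM /=.
by rewrite mulrAC [_ * G i j]mulrC mulrA.
Qed.

Lemma spec_formE n (Q : 'M[C]_n) (l : 'I_n -> R) v :
  frm (spec Q l) v v = (qf (spec Q l) v)%:C.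
Proof.
rewrite qf_spec /frm specE !mulmxA; set w := v *m Q^t*.
have -> : w *m diag_mx (\row_i (l i)%:C) *m Q *m v^t* =
    w *m diag_mx (\row_i (l i)%:C) *m w^t*.
  by rewrite /w adjM trmxCK !mulmxA.
rewrite mul_mx_diag mxE rmorph_sum; apply: eq_bigr => i _.
by rewrite !mxE rmorphM /= csqE; ring.
Qed.

Lemma spec_psdmx n (Q : 'M[C]_n) (l : 'I_n -> R) : (forall i, 0 <= l i) ->
  psdmx (spec Q l).
Proof.
move=> l0; split=> [|v]; first exact/hermP/spec_adj.
(* [psdmx] tests columns and [qf] tests rows; the two are matched by the adjoint. *)
rewrite -{2}[v]trmxCK.
rewrite -[X in 0 <= X]/(frm (spec Q l) (v^t*) (v^t*)) spec_formE.
by rewrite ler0c qf_spec sumr_ge0 // => i _; rewrite mulr_ge0 ?csq_ge0.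
Qed.

Lemma spec_sub n (Q : 'M[C]_n) f g :
  spec Q f - spec Q g = spec Q (fun i => f i - g i).
Proof.
rewrite !specE -mulmxBl -mulmxBr -linearB.
suff -> : \row_i (f i)%:C - \row_i (g i)%:C = \row_i (f i - g i)%:C :> 'rV[C]_n by [].
by apply/rowP => i; rewrite !mxE rmorphB.
Qed.

(* Horn's theorem makes the diagonal of a unitary conjugate of [Y] dominate [s];
   the diagonal part is an average of [n] unitary conjugates. *)
Lemma weak_major_average n (V W : 'M[C]_n) (s y : nat -> R) : (n > 0)%N ->
  V \is unitarymx -> W \is unitarymx ->
  (forall i j, (i <= j)%N -> s j <= s i) -> (forall i j, (i <= j)%N -> y j <= y i) ->
  (forall k, (k <= n)%N -> \sum_(i < k) s i <= \sum_(i < k) y i) ->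
  exists U : 'I_n -> 'M[C]_n, (forall i, U i \is unitarymx) /\
    loewner_le (spec V (fun i => s i))
      ((n%:R : C)^-1 *: \sum_i (U i *m spec W (fun i => y i) *m (U i)^t*)).
Proof.
move=> n0 uV uW sm ym h; set Y := spec W _.
pose x i := if insub i is Some j then row j W else 0.
have xE (i : 'I_n) : x i = row i W by rewrite /x valK.
have xo i j : (i < n)%N -> (j < n)%N -> frm 1%:M (x i) (x j) = (i == j)%:R.
  move=> ilt jlt; rewrite (xE (Ordinal ilt)) (xE (Ordinal jlt)).
  by rewrite /frm mulmx1 row_unitary.
have xY i j : (i < n)%N -> (j < n)%N -> frm Y (x i) (x j) = (y i)%:C * (i == j)%:R.
  move=> ilt jlt; rewrite (xE (Ordinal ilt)) (xE (Ordinal jlt)).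
  by rewrite /frm mul_row_spec // -scalemxAl mxE row_unitary.
have [z [zo _ zs]] := weak_horn sm ym h xo xY.
pose Z := \matrix_(i < n) z i.
have uZ : Z \is unitarymx.
  apply/row_unitarymxP => i j; rewrite dotmxE !rowK.
  by have := zo i j (ltn_ord i) (ltn_ord j); rewrite /frm mulmx1.
have [D [uD pD]] := pinching n0.
pose G := Z *m Y *m Z^t*.
have gE (i : 'I_n) : G i i = (qf Y (z i))%:C.
  rewrite -spec_formE /frm -(rowK z i) -/Z -/Y -row_mul /G.
  rewrite [LHS]mxE [RHS]mxE; apply: eq_bigr => j _.
  by rewrite ![in RHS]mxE ![in LHS]mxE.
(* [Z] produces the dominating diagonal, [D l] averages away the rest, and [V^t*] moves that
   diagonal to the basis in which the smaller matrix is diagonal. *)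
exists (fun l => V^t* *m D l *m Z); split.
  by move=> l; exact: (mul_unitarymx (mul_unitarymx (unitary_adj uV) (uD l)) uZ).
rewrite /loewner_le.
have -> : (n%:R : C)^-1 *: \sum_i (V^t* *m D i *m Z *m Y *m (V^t* *m D i *m Z)^t*) =
    spec V (fun i => qf Y (z i)).
  have -> : \sum_i (V^t* *m D i *m Z *m Y *m (V^t* *m D i *m Z)^t*) =
      V^t* *m (\sum_i (D i *m G *m (D i)^t*)) *m V.
    rewrite mulmx_sumr mulmx_suml; apply: eq_bigr => i _.
    by rewrite !adjM trmxCK /G !mulmxA.
  rewrite scalemxAl scalemxAr pD specE.
  suff -> : \row_i G i i = \row_i (qf Y (z i))%:C :> 'rV[C]_n by [].
  by apply/rowP => i; rewrite [LHS]mxE [RHS]mxE gE.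
by rewrite spec_sub; apply: spec_psdmx => i; rewrite subr_ge0 zs.
Qed.

End Pinching.

Theorem corollary2p5 (R : realType) (d m : nat) (hd : (1 <= d)%N)
    (hm : (1 <= m)%N) (A : 'I_m -> 'M[R[i]]_d)
    (hA : forall k, A k \is normalmx) (q : R) (hq0 : 0 < q) (hq1 : q <= 1) :
  exists V : 'I_d -> 'M[R[i]]_d,
    (forall i, V i \is unitarymx) /\
    loewner_le (mxabs (\sum_(k < m) A k))
      ((d%:R : R[i])^-1 *:
        \sum_(i < d)
          (V i *m mxpow (\sum_(k < m) mxpow (mxabs (A k)) q) (q^-1)
             *m (V i)^t*)).
Proof.
have q01 : 0 < q <= 1 by rewrite hq0.
have [Q hQ] := fin_all_exists (fun k => normal_mxabs (hA k)).
have [mu hmu] := fin_all_exists hQ.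
have uQ k : Q k \is unitarymx by case: (hmu k).
have mu0 k i : 0 <= mu k i by case: (hmu k).
have absE k : mxabs (A k) = spec (Q k) (mu k) by case: (hmu k).
have absA k u v : 2 * complex.Re ((u *m A k *m v^t*) 0 0) <=
    qf (mxabs (A k)) u + qf (mxabs (A k)) v by case: (hmu k).
have sum_spec (l : 'I_m -> 'I_d -> R) : (forall k i, 0 <= l k i) ->
    exists P (la : nat -> R), [/\ P \is unitarymx, forall i j, (i <= j)%N -> la j <= la i,
      forall i, 0 <= la i & \sum_k spec (Q k) (l k) = spec P (fun i => la i)].
  move=> l0; apply: psd_sorted_spectral => [|v].
    by apply/hermP; rewrite adj_sum; apply: eq_bigr => k _; exact: spec_adj.
  rewrite qf_sum sumr_ge0 // => k _; rewrite qf_spec sumr_ge0 // => i _.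
  by rewrite mulr_ge0 ?csq_ge0.
(* From here [la], [be] and [s] list in nonincreasing order the eigenvalues of S, of B and of
   |T|. *)
have [P [la [uP lam la0 ES]]] := sum_spec mu mu0.
have [W [be [uW bem be0 EB]]] := sum_spec _ (fun k i => powR_ge0 (mu k i) q).
have [V [s [uV sm s0 ET ETT]]] := mxabs_sorted (\sum_k A k).
have s_la k : (k <= d)%N -> \sum_(i < k) s i <= \sum_(i < k) la i.
  apply: (weak_major_of_sesqui_le uV uP sm s0 lam la0 ETT) => u v.
  rewrite -ES !qf_sum -big_split mulmx_sumr mulmx_suml summxE Re_sum mulr_sumr.
  by apply: ler_sum => i _; rewrite -absE; exact: absA.
have laq k : (k <= d)%N -> \sum_(i < k) powR (la i) q <= \sum_(i < k) be i.
  exact: (sum_pow_ky_fan_le uQ uP uW mu0 la0 lam bem ES EB q01).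
have la_be := powR_weak_major q01 lam la0 be0 laq.
have -> : mxpow (\sum_k mxpow (mxabs (A k)) q) q^-1 =
    spec W (fun i => powR (be i) q^-1).
  have -> : \sum_k mxpow (mxabs (A k)) q = spec W (fun i => be i).
    rewrite -EB; apply: eq_bigr => k _; rewrite (absE k).
    exact: (mxfunE (mu k) (fun x => powR x q) (uQ k)).
  exact: mxfunE.
rewrite ET; apply: (@weak_major_average _ _ _ _ s (fun i => powR (be i) q^-1)) => //.
- move=> i j ij; apply: ge0_ler_powR; rewrite ?nnegrE ?invr_ge0 ?be0 ?bem //.
  exact: ltW.
- by move=> k kd; apply: le_trans (s_la k kd) (la_be k kd).
Qed.
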